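(* Let $m\ge 3$, $n\ge 3$, let $W_m$ be the wheel with $m$ rim vertices and $C_n$ the cycle on $n$ vertices, and let $\Delta$ be the maximum degree of $W_m\times C_n$. Then $\chi''_{\Sigma}(W_m\times C_n)=\Delta+2$.
   Context: All graphs are finite and simple. A proper total $k$-coloring of a graph $G$ assigns to every vertex and every edge a color from $\{1,\dots,k\}$ such that adjacent vertices receive different colors, edges sharing an endpoint receive different colors, and no edge receives the same color as either of its endpoints. For such a coloring $c$ and a vertex $v$, let $f(v)=c(v)+\sum_{e\ni v} c(e)$. The coloring distinguishes adjacent vertices by sums if $f(u)\neq f(v)$ for every edge $uv$. $\chi''_{\Sigma}(G)$ denotes the smallest $k$ such that $G$ has a proper total $k$-coloring distinguishing adjacent vertices by sums. The product $G_1\times G_2$ is the Cartesian product: vertex set $V(G_1)\times V(G_2)$, with $(u_1,u_2)$ adjacent to $(v_1,v_2)$ iff either $u_1=v_1$ and $u_2v_2\in E(G_2)$, or $u_1v_1\in E(G_1)$ and $u_2=v_2$. The wheel $W_m$ consists of a cycle on $m$ vertices together with a central vertex adjacent to all of them ($W_3=K_4$). *)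

(* Defs.v *)
From mathcomp Require Import all_boot.

Set Implicit Arguments.
Unset Strict Implicit.
Unset Printing Implicit Defensive.

Record sgraph := SGraph {
  vertex :> finType;
  adj : rel vertex;
  adj_sym : symmetric adj;
  adj_irr : irreflexive adj }.

(* An edge is the unordered pair of its endpoints. *)
Definition edges (G : sgraph) : {set {set G}} :=
  [set [set p.1; p.2] | p in [pred p : G * G | adj p.1 p.2]].

Definition degree (G : sgraph) (x : G) : nat := #|[set y | adj x y]|.

Definition max_degree (G : sgraph) : nat := \max_(x : G) degree x.

(* Values of ce on sets that are not edges are irrelevant. *)
Definition proper_total_coloring (G : sgraph) (k : nat)
    (cv : G -> nat) (ce : {set G} -> nat) : Prop :=
  [/\ forall x : G, 1 <= cv x <= k,
      forall e, e \in edges G -> 1 <= ce e <= k,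
      forall x y : G, adj x y -> cv x != cv y,
      forall e1 e2, e1 \in edges G -> e2 \in edges G -> e1 != e2 ->
        e1 :&: e2 != set0 -> ce e1 != ce e2
    & forall e (x : G), e \in edges G -> x \in e -> ce e != cv x].

Definition color_sum (G : sgraph) (cv : G -> nat) (ce : {set G} -> nat)
    (x : G) : nat :=
  cv x + \sum_(e in edges G | x \in e) ce e.

Definition sum_distinguishing (G : sgraph)
    (cv : G -> nat) (ce : {set G} -> nat) : Prop :=
  forall x y : G, adj x y -> color_sum cv ce x != color_sum cv ce y.

Definition nsd_total_colorable (G : sgraph) (k : nat) : Prop :=
  exists (cv : G -> nat) (ce : {set G} -> nat),
    proper_total_coloring k cv ce /\ sum_distinguishing cv ce.

(* chi''_Sigma(G) = k *)
Definition is_nsd_total_chromatic_number (G : sgraph) (k : nat) : Prop :=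
  nsd_total_colorable G k /\ (forall j, nsd_total_colorable G j -> k <= j).

Section Product.
Variables G1 G2 : sgraph.

Definition cart_adj : rel (G1 * G2)%type := fun u v =>
  (u.1 == v.1) && adj u.2 v.2 || adj u.1 v.1 && (u.2 == v.2).

Lemma cart_adj_sym : symmetric cart_adj.
Proof.
by move=> u v; rewrite /cart_adj ![_ == v.1]eq_sym ![_ == v.2]eq_sym !(adj_sym u.1)
  !(adj_sym u.2).
Qed.

Lemma cart_adj_irr : irreflexive cart_adj.
Proof. by move=> u; rewrite /cart_adj !adj_irr andbF. Qed.

Definition cart_prod : sgraph := SGraph cart_adj_sym cart_adj_irr.

End Product.

(* ordS is the successor modulo n; the condition i != j only matters for
   n = 1, where it removes the loop. *)
Definition cycle_adj (n : nat) : rel 'I_n := fun i j =>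
  (i != j) && ((ordS i == j) || (ordS j == i)).

Lemma cycle_adj_sym n : symmetric (@cycle_adj n).
Proof. by move=> i j; rewrite /cycle_adj eq_sym orbC. Qed.

Lemma cycle_adj_irr n : irreflexive (@cycle_adj n).
Proof. by move=> i; rewrite /cycle_adj eqxx. Qed.

Definition cycle_graph (n : nat) : sgraph :=
  SGraph (@cycle_adj_sym n) (@cycle_adj_irr n).

(* None is the hub, Some i the rim vertices. *)
Definition wheel_adj (m : nat) : rel (option 'I_m) := fun u v =>
  match u, v with
  | Some i, Some j => cycle_adj i j
  | None, None => false
  | _, _ => true
  end.

Lemma wheel_adj_sym m : symmetric (@wheel_adj m).
Proof. by case=> [i|] [j|] //=; exact: cycle_adj_sym. Qed.

Lemma wheel_adj_irr m : irreflexive (@wheel_adj m).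
Proof. by case=> [i|] //=; exact: cycle_adj_irr. Qed.

Definition wheel (m : nat) : sgraph :=
  SGraph (@wheel_adj_sym m) (@wheel_adj_irr m).

(* Main.v *)
Require Import Defs.
From mathcomp Require Import all_boot.
From mathcomp Require Import zify.

(* The hubs form a cycle of adjacent vertices of maximum degree [m + 2]. With
   [m + 3] colors each of them would see every color, so two adjacent hubs would
   have equal sums; hence [m + 4] colors are necessary.

   With [m + 4] colors every hub misses exactly one color, and adjacent hubs are
   distinguished as soon as their missing colors differ. For [m >= 11] one colors
   greedily the hub cycle together with the missing colors, then the edges joining
   rim vertices, then the rim vertices: the last step has at most
   5 (edges) + 1 (hub) + 4 (neighbours) + 4 (sums) = 14 forbidden colors, and the sum
   at a hub exceeds any sum of six colors. For [3 <= m <= 10] the layers of the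
   product repeat along a closed walk of any length [n >= 3] in a fixed finite graph of
   layer types, so that explicit tables with finitely many checks suffice. *)

Set Implicit Arguments.
Unset Strict Implicit.
Unset Printing Implicit Defensive.

(** * Edge colorings as symmetric weights *)

Lemma set2_inj2 (T : finType) (x y a b : T) :
  x != y -> [set x; y] = [set a; b] -> (a = x /\ b = y) \/ (a = y /\ b = x).
Proof.
move=> xy e.
have : x \in [set a; b] by rewrite -e set21.
have : y \in [set a; b] by rewrite -e set22.
by case/set2P=> <-; case/set2P=> ey; rewrite ?ey ?eqxx // in xy *; [right|left].
Qed.

Lemma set2_injr (T : finType) (x y z : T) :
  x != y -> [set x; y] = [set x; z] -> y = z.
Proof. by move=> xy /(set2_inj2 xy) [[]|[eqxy _]] //; rewrite eqxy eqxx in xy. Qed.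

Section Weights.

Variable G : sgraph.
Implicit Types (x y z : G) (w : G -> G -> nat) (e : {set G}).

Lemma adj_neq x y : adj x y -> x != y.
Proof. by apply: contraTneq => ->; rewrite adj_irr. Qed.

Lemma edgesP e : reflect (exists x y, adj x y /\ e = [set x; y]) (e \in edges G).
Proof.
apply: (iffP imsetP) => [[[x y] xy ->]|[x [y [xy ->]]]]; first by exists x, y.
by exists (x, y).
Qed.

Lemma mem_edges x y : adj x y -> [set x; y] \in edges G.
Proof. by move=> xy; apply/edgesP; exists x, y. Qed.

Lemma edges_atP e x : e \in edges G -> x \in e -> exists2 y, adj x y & e = [set x; y].
Proof.
case/edgesP=> a [b [ab ->]] /set2P [] ->; first by exists b.
by exists a; rewrite 1?adj_sym // setUC.
Qed.

(** Adjacency is irreflexive, so [y |-> [set x; y]] is a bijection from the neighbours of [x] to the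
    edges at [x]. *)
Lemma sum_edges_at x (F : {set G} -> nat) :
  \sum_(e in edges G | x \in e) F e = \sum_(y | adj x y) F [set x; y].
Proof.
have inj : {in [pred y | adj x y] &, injective (fun y => [set x; y])}.
  by move=> y z xy _; apply: set2_injr; apply: adj_neq.
rewrite -(big_imset F inj) /=; apply: eq_bigl => e.
apply/andP/imsetP => [[eG xe]|[y xy ->]].
  by have [y xy ->] := edges_atP eG xe; exists y.
by rewrite mem_edges ?set21.
Qed.

(** [pick] chooses one of the two orientations of [e], and for a symmetric [w] the choice is
    immaterial. The value 0 is taken only on sets that are not edges. *)
Definition edge_color w e : nat :=
  if [pick p : G * G | adj p.1 p.2 && (e == [set p.1; p.2])] is Some p
  then w p.1 p.2 else 0.

Lemma edge_colorE w x y :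
  (forall a b, adj a b -> w a b = w b a) -> adj x y ->
  edge_color w [set x; y] = w x y.
Proof.
move=> wC xy; rewrite /edge_color; case: pickP => [[a b] /= /andP[ab /eqP e]|/(_ (x, y))].
  by case: (set2_inj2 (adj_neq xy) e) => [] [-> ->] //; rewrite wC // adj_sym.
by rewrite /= xy eqxx.
Qed.

(** From here on an edge coloring is a function of ordered pairs of vertices, which can be given by
    formulas. Two distinct edges that meet in [x] become two distinct neighbours of [x]. *)
Lemma nsd_of_weights (k : nat) (cv : G -> nat) w :
  (forall x y, adj x y -> w x y = w y x) ->
  (forall x, 1 <= cv x <= k) ->
  (forall x y, adj x y -> 1 <= w x y <= k) ->
  (forall x y, adj x y -> cv x != cv y) ->
  (forall x y z, adj x y -> adj x z -> y != z -> w x y != w x z) ->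
  (forall x y, adj x y -> w x y != cv x) ->
  (forall x y, adj x y -> cv x + \sum_(z | adj x z) w x z
                          != cv y + \sum_(z | adj y z) w y z) ->
  nsd_total_colorable G k.
Proof.
move=> wC cvk wk cvP wP cvw wS; exists cv, (edge_color w); split; last first.
  move=> x y xy; rewrite /color_sum !sum_edges_at.
  rewrite (eq_bigr (w x)); last by move=> z; apply: edge_colorE.
  rewrite [in X in _ != X](eq_bigr (w y)); last by move=> z; apply: edge_colorE.
  exact: wS.
split=> //.
- by move=> e /edgesP [x [y [xy ->]]]; rewrite edge_colorE // wk.
- move=> e1 e2 e1G e2G ne /set0Pn [x /setIP [xe1 xe2]].
  have [y xy eq1] := edges_atP e1G xe1; have [z xz eq2] := edges_atP e2G xe2.
  subst; rewrite !edge_colorE // wP //.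
  by apply: contraNneq ne => ->.
- by move=> e x eG xe; have [y xy ->] := edges_atP eG xe; rewrite edge_colorE // cvw.
Qed.

(** The colors at a vertex of degree [d], its own included, are [d + 1] distinct members of
    [1, ..., k]. If [k = d + 1], they are all of them, so the sum at the vertex depends on [k]
    only. *)
Lemma sum_distinguishing_lower_bound (x y : G) (k : nat) :
  adj x y -> degree x = degree y -> nsd_total_colorable G k ->
  (degree x).+2 <= k.
Proof.
move=> xy dxy [cv [ce [[cvk cek cvP ceP cvce] sd]]].
pose pal z := cv z :: [seq ce [set z; t] | t <- enum [set t | adj z t]].
have size_pal z : size (pal z) = (degree z).+1 by rewrite /= size_map -cardE.
have uniq_pal z : uniq (pal z).
  rewrite /= map_inj_in_uniq ?enum_uniq ?andbT.
    apply/mapP => -[t]; rewrite mem_enum inE => zt eq.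
    by have := cvce _ z (mem_edges zt) (set21 _ _); rewrite eq eqxx.
  move=> s t; rewrite !mem_enum !inE => zs zt; apply: contra_eq => st.
  apply: ceP; rewrite ?mem_edges //.
    by apply: contra_neq st; apply: set2_injr (adj_neq zs).
  by apply/set0Pn; exists z; rewrite !inE eqxx.
have sub_pal z : {subset pal z <= iota 1 k}.
  move=> c; rewrite inE mem_iota add1n ltnS => /predU1P [->|/mapP [t]]; first exact: cvk.
  by rewrite mem_enum inE => zt ->; apply/cek/mem_edges.
have sum_pal z : sumn (pal z) = color_sum cv ce z.
  rewrite /= /color_sum sum_edges_at; congr (_ + _).
  by rewrite sumnE big_map big_enum_cond /=; apply: eq_bigl => t; rewrite inE andbT.
have le_k : (degree x).+1 <= k.
  by rewrite -size_pal -(size_iota 1 k); apply: uniq_leq_size.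
rewrite ltn_neqAle le_k andbT; apply: contraTneq (sd _ _ xy) => eqk.
(* The remaining case is [k = degree x + 1], which makes the palettes of [x] and [y] permutations of
   the same list. *)
have full z : degree z = degree x -> perm_eq (pal z) (iota 1 k).
  move=> dz; apply: uniq_perm; rewrite ?iota_uniq //.
  by apply: (uniq_min_size _ (@sub_pal z) _).2; rewrite // size_iota size_pal dz eqk.
rewrite negbK -!sum_pal.
by rewrite (perm_sumn (full x erefl)) (perm_sumn (full y (esym dxy))).
Qed.

End Weights.

(** * Cartesian products with a cycle *)

Lemma modnS_lt (n i : nat) : i < n -> i.+1 %% n = if i.+1 == n then 0 else i.+1.
Proof. by move=> lt_in; case: eqP => [->|ne]; rewrite ?modnn // modn_small; lia. Qed.

Lemma val_ordS n (i : 'I_n) : ordS i = (if i.+1 == n then 0 else i.+1) :> nat.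
Proof. exact: modnS_lt. Qed.

Lemma ordS_neq n (i : 'I_n) : 1 < n -> ordS i != i.
Proof.
by move=> n1; apply/eqP => e; have := val_ordS i; rewrite e; case: ifP => /eqP; lia.
Qed.

Lemma ordS2_neq n (i : 'I_n) : 2 < n -> ordS (ordS i) != i.
Proof.
move=> n2; apply/eqP => e; have := val_ordS (ordS i); rewrite e val_ordS.
by do 2 case: ifP => /eqP; lia.
Qed.

Lemma ord_pred_neq n (i : 'I_n) : 1 < n -> ord_pred i != i.
Proof. by move=> n1; rewrite -{2}[i]ord_predK eq_sym ordS_neq. Qed.

Lemma ordS_neq_pred n (i : 'I_n) : 2 < n -> ordS i != ord_pred i.
Proof. by move=> n2; rewrite -{1}[i]ord_predK ordS2_neq. Qed.

Lemma cycle_adjE n (i j : 'I_n) : 1 < n ->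
  cycle_adj i j = (j == ordS i) || (j == ord_pred i).
Proof.
move=> n1; rewrite /cycle_adj (eq_sym (ordS i)).
rewrite (can2_eq (@ordSK n) (@ord_predK n)).
case: eqVneq => //= <-; rewrite eq_sym (negbTE (ordS_neq _ n1)).
by rewrite eq_sym (negbTE (ord_pred_neq _ n1)).
Qed.

(** Here [f i] is the value on the edge from [i] to [ordS i]. It can be read from either end because
    [2 < n] excludes [ordS (ordS i) = i]. *)
Lemma cycle_weightC (T : Type) n (f : 'I_n -> T) (i j : 'I_n) :
  2 < n -> cycle_adj i j ->
  (if j == ordS i then f i else f j) = (if i == ordS j then f j else f i).
Proof.
move=> n2; rewrite cycle_adjE 1?ltnW // => /orP [] /eqP ->.
  by rewrite eqxx eq_sym (negbTE (ordS2_neq _ n2)).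
by rewrite ord_predK eqxx eq_sym (negbTE (ordS_neq_pred _ n2)).
Qed.

Section CartCycle.

Variables (G : sgraph) (n : nat).
Hypothesis n_gt2 : 2 < n.
Local Notation GC := (cart_prod G (cycle_graph n)).

Lemma adj_cart_cycle (a b : G) (i j : 'I_n) :
  @adj GC (a, i) (b, j) =
  [|| adj a b && (i == j), (b, j) == (a, ordS i) | (b, j) == (a, ord_pred i)].
Proof.
rewrite /= /cart_adj /= cycle_adjE 1?ltnW // !xpair_eqE (eq_sym a).
by case: (b == a); rewrite ?orbF //= orbC.
Qed.

Lemma adj_cart_cycleP (u v : GC) : adj u v ->
  [\/ adj u.1 v.1 /\ v = (v.1, u.2), v = (u.1, ordS u.2) | v = (u.1, ord_pred u.2)].
Proof.
case: u v => a i [b j]; rewrite adj_cart_cycle => /or3P [/andP[ab /eqP ->]|/eqP|/eqP].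
- exact: Or31.
- exact: Or32.
- exact: Or33.
Qed.

Lemma sum_adj_cart_cycle (F : GC -> nat) (a : G) (i : 'I_n) :
  \sum_(v | @adj GC (a, i) v) F v =
  \sum_(b | adj a b) F (b, i) + F (a, ordS i) + F (a, ord_pred i).
Proof.
have n1 := ltnW n_gt2.
pose P (v : G * 'I_n) :=
  [|| adj a v.1 && (i == v.2), v == (a, ordS i) | v == (a, ord_pred i)].
rewrite (eq_bigl P); last by move=> [b j]; rewrite adj_cart_cycle.
rewrite /P (bigD1 (a, ordS i)) /=; last by rewrite eqxx orbT.
rewrite (bigD1 (a, ord_pred i)) /=; last first.
  by rewrite !eqxx !orbT xpair_eqE eqxx eq_sym ordS_neq_pred.
rewrite addnCA addnC [X in X + _]addnC; congr (_ + _ + _).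
(* With the two vertices in the adjacent layers split off, all remaining neighbours lie in layer
   [i]. *)
rewrite (reindex_onto (fun b : G => (b, i)) fst) /=; last first.
  move=> [b j] /andP [/andP []].
  by case/or3P=> [/andP [_ /eqP ->]|->|->] //=; rewrite andbF.
apply: eq_bigl => b; rewrite !xpair_eqE !eqxx andbT.
by rewrite ![i == _]eq_sym (negbTE (ordS_neq _ n1)) (negbTE (ord_pred_neq _ n1))
  !andbF !orbF !andbT.
Qed.

Section Coloring.

Variables (k : nat) (cv : 'I_n -> G -> nat) (wl : 'I_n -> G -> G -> nat)
  (ve : 'I_n -> G -> nat).

(** [wl j] colors the edges inside layer [j], and [ve j a] the edge from [(a, j)] to [(a, ordS j)].
    Hence [ve (ord_pred j) a] is the color of the edge arriving at [(a, j)] from the preceding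
    layer. *)
Definition layer_sum (j : 'I_n) (a : G) : nat :=
  cv j a + (\sum_(b | adj a b) wl j a b + ve j a + ve (ord_pred j) a).

Let w (u v : GC) : nat :=
  if u.2 == v.2 then wl u.2 u.1 v.1
  else if v.2 == ordS u.2 then ve u.2 u.1 else ve v.2 v.1.

Let wS a i : w (a, i) (a, ordS i) = ve i a.
Proof. by rewrite /w /= eq_sym (negbTE (ordS_neq _ (ltnW n_gt2))) eqxx. Qed.

Let wP a i : w (a, i) (a, ord_pred i) = ve (ord_pred i) a.
Proof.
rewrite /w /= eq_sym (negbTE (ord_pred_neq _ (ltnW n_gt2))).
by rewrite eq_sym (negbTE (ordS_neq_pred _ n_gt2)).
Qed.

Let wL a b i : w (a, i) (b, i) = wl i a b.
Proof. by rewrite /w /= eqxx. Qed.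

(** Between layers, only the step from [j] to [ordS j] is constrained in the hypotheses. The
    backward step at [j] is the forward step at [ord_pred j]. *)
Lemma nsd_cart_cycle :
  (forall j a b, adj a b -> wl j a b = wl j b a) ->
  (forall j a, 1 <= cv j a <= k) ->
  (forall j a b, adj a b -> 1 <= wl j a b <= k) ->
  (forall j a, 1 <= ve j a <= k) ->
  (forall j a b, adj a b -> cv j a != cv j b) ->
  (forall j a, cv j a != cv (ordS j) a) ->
  (forall j a b c, adj a b -> adj a c -> b != c -> wl j a b != wl j a c) ->
  (forall j a b, adj a b -> wl j a b \notin [:: cv j a; ve j a; ve (ord_pred j) a]) ->
  (forall j a, uniq [:: cv j a; ve j a; ve (ord_pred j) a]) ->
  (forall j a b, adj a b -> layer_sum j a != layer_sum j b) ->
  (forall j a, layer_sum j a != layer_sum (ordS j) a) ->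
  nsd_total_colorable GC k.
Proof.
move=> wlC cvk wlk vek cvL cvS wlP wlN vU sL sS.
have vN j a : [/\ cv j a != ve j a, cv j a != ve (ord_pred j) a
                & ve j a != ve (ord_pred j) a].
  by have := vU j a; rewrite /= !inE !negb_or !andbT => /andP [/andP [-> ->] ->].
apply: (@nsd_of_weights GC k (fun u => cv u.2 u.1) w).
- move=> [a i] v /adj_cart_cycleP /= [[ab ->]|->|->]; rewrite ?wL ?wS ?wP.
  + exact: wlC.
  + by have := wP a (ordS i); rewrite ordSK => ->.
  + by have := wS a (ord_pred i); rewrite ord_predK => ->.
- by move=> u.
- by move=> [a i] v /adj_cart_cycleP /= [[ab ->]|->|->]; rewrite ?wL ?wS ?wP ?wlk.
- move=> [a i] v /adj_cart_cycleP /= [[ab ->]|->|->] //=; first exact: cvL.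
  by rewrite -{1}[i]ord_predK eq_sym.
- have H a b i : adj a b -> wl i a b != ve i a /\ wl i a b != ve (ord_pred i) a.
    by move/(wlN i); rewrite !inE !negb_or => /and3P [].
  move=> [a i] v1 v2 /adj_cart_cycleP /= e1 /adj_cart_cycleP /= e2.
  case: e1 => [[ab ->]|->|->]; case: e2 => [[ac ->]|->|->] //=;
    rewrite ?wL ?wS ?wP ?eqxx //.
  + by rewrite xpair_eqE eqxx andbT; apply: wlP.
  + by have [] := H _ _ i ab.
  + by have [] := H _ _ i ab.
  + by move=> _; rewrite eq_sym; have [] := H _ _ i ac.
  + by have [] := vN i a.
  + by move=> _; rewrite eq_sym; have [] := H _ _ i ac.
  + by move=> _; rewrite eq_sym; have [] := vN i a.
- move=> [a i] v /adj_cart_cycleP /= [[ab ->]|->|->]; rewrite ?wL ?wS ?wP.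
  + by have := wlN i _ _ ab; rewrite !inE !negb_or => /and3P [].
  + by rewrite eq_sym; have [] := vN i a.
  + by rewrite eq_sym; have [] := vN i a.
- have sE a i : cv i a + \sum_(v | @adj GC (a, i) v) w (a, i) v = layer_sum i a.
    rewrite sum_adj_cart_cycle wS wP; congr (_ + (_ + _ + _)).
    by apply: eq_bigr => b _; apply: wL.
  move=> [a i] v /adj_cart_cycleP /= [[ab ->]|->|->]; rewrite /= !sE.
  + exact: sL.
  + exact: sS.
  + by rewrite -{1}[i]ord_predK eq_sym.
Qed.

End Coloring.

End CartCycle.

(** * Wheels *)

Section Wheel.

Variable m : nat.
Hypothesis m_gt2 : 2 < m.

Definition wheel_weight (sp re : 'I_m -> nat) (u v : option 'I_m) : nat :=
  match u, v with
  | Some i, Some j => if j == ordS i then re i else re j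
  | Some i, None | None, Some i => sp i
  | None, None => 0
  end.

Lemma adj_wheel_rim (i : 'I_m) (v : wheel m) :
  @adj (wheel m) (Some i) v -> [\/ v = None, v = Some (ordS i) | v = Some (ord_pred i)].
Proof.
case: v => [j|]; last by move=> _; exact: Or31.
rewrite /= cycle_adjE 1?ltnW // => /orP [] /eqP ->; first exact: Or32.
exact: Or33.
Qed.

Lemma wheel_weightC sp re (u v : wheel m) :
  adj u v -> wheel_weight sp re u v = wheel_weight sp re v u.
Proof. by case: u v => [i|] [j|] //= ij; rewrite cycle_weightC. Qed.

Lemma wheel_weightS sp re (i : 'I_m) :
  wheel_weight sp re (Some i) (Some (ordS i)) = re i.
Proof. by rewrite /= eqxx. Qed.

Lemma wheel_weightP sp re (i : 'I_m) :
  wheel_weight sp re (Some i) (Some (ord_pred i)) = re (ord_pred i).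
Proof. by rewrite /= eq_sym (negbTE (ordS_neq_pred _ m_gt2)). Qed.

Lemma big_option (T : finType) (P : pred (option T)) (F : option T -> nat) :
  \sum_(x | P x) F x =
  (if P None then F None else 0) + \sum_(x | P (Some x)) F (Some x).
Proof.
rewrite big_mkcond [in RHS](big_mkcond (fun x => P (Some x))) /=.
rewrite (bigD1 None) //=; congr (_ + _).
rewrite (reindex_omap Some id) /=; last by case.
by apply: eq_bigl => x; rewrite eqxx.
Qed.

Lemma sum_wheel_hub (F : wheel m -> nat) :
  \sum_(v | @adj (wheel m) None v) F v = \sum_(i < m) F (Some i).
Proof. by rewrite big_option. Qed.

Lemma sum_wheel_rim (F : wheel m -> nat) (i : 'I_m) :
  \sum_(v | @adj (wheel m) (Some i) v) F v =
  F None + (F (Some (ordS i)) + F (Some (ord_pred i))).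
Proof.
rewrite big_option /=; congr (_ + _).
rewrite (eq_bigl (fun j => (j == ordS i) || (j == ord_pred i))); last first.
  by move=> j; apply: cycle_adjE; apply: ltnW.
rewrite (bigD1 (ordS i)) ?eqxx //=; congr (_ + _).
rewrite (big_pred1 (ord_pred i)) // => j /=.
case: (eqVneq j (ord_pred i)) => [->|_]; first by rewrite orbT eq_sym ordS_neq_pred.
by rewrite orbF andbN.
Qed.

End Wheel.

(* [rv], [hv]: rim and hub vertices; [sp]: spokes; [re j i]: rim edge from [i] to
   [ordS i] in layer [j]; [ve j i], [he j]: edges from layer [j] to [ordS j]. *)
Record wheel_cycle_coloring (m n k : nat) (hv he : 'I_n -> nat)
    (rv sp re ve : 'I_n -> 'I_m -> nat) : Prop := WheelCycleColoring {
  hub_range : forall j, all (fun c => 1 <= c <= k) [:: hv j; he j];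
  rim_range : forall j i,
    all (fun c => 1 <= c <= k) [:: rv j i; sp j i; re j i; ve j i];
  hub_uniq : forall j,
    uniq [:: hv j, he j, he (ord_pred j) & [seq sp j i | i <- enum 'I_m]];
  rim_uniq : forall j i,
    uniq [:: rv j i; sp j i; re j i; re j (ord_pred i); ve j i; ve (ord_pred j) i];
  hub_proper : forall j, hv j != hv (ordS j);
  rim_proper : forall j i,
    rv j i \notin [:: hv j; rv j (ordS i); rv (ordS j) i];
  hub_sum := fun j => hv j + (\sum_i sp j i + he j + he (ord_pred j));
  rim_sum := fun j i =>
    rv j i + (sp j i + (re j i + re j (ord_pred i)) + ve j i + ve (ord_pred j) i);
  hub_distinguished : forall j, hub_sum j != hub_sum (ordS j);
  rim_distinguished : forall j i,
    rim_sum j i \notin [:: hub_sum j; rim_sum j (ordS i); rim_sum (ordS j) i] }.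

(** Around the rim, as between layers, conditions towards the successor suffice: those towards
    [ord_pred i] are the same ones read at [ord_pred i]. *)
Lemma nsd_wheel_cycle (m n k : nat) hv he rv sp re ve :
  2 < m -> 2 < n -> @wheel_cycle_coloring m n k hv he rv sp re ve ->
  nsd_total_colorable (cart_prod (wheel m) (cycle_graph n)) k.
Proof.
move=> m2 n2 [hR rR hU rU hP rP hS rS hD rD].
have hR' j : 1 <= hv j <= k /\ 1 <= he j <= k by have := hR j; rewrite /= => /and3P [].
have rR' j i : [/\ 1 <= rv j i <= k, 1 <= sp j i <= k, 1 <= re j i <= k
                 & 1 <= ve j i <= k] by have := rR j i; rewrite /= => /and5P [].
have rP' j i : [/\ rv j i != hv j, rv j i != rv j (ordS i) & rv j i != rv (ordS j) i].
  by have := rP j i; rewrite !inE !negb_or => /and3P [].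
have rD' j i :
    [/\ rS j i != hS j, rS j i != rS j (ordS i) & rS j i != rS (ordS j) i].
  by have := rD j i; rewrite !inE !negb_or => /and3P [].
pose cv j (a : wheel m) := if a is Some i then rv j i else hv j.
pose vv j (a : wheel m) := if a is Some i then ve j i else he j.
pose wl j (a b : wheel m) := wheel_weight (sp j) (re j) a b.
have sumE j a : layer_sum cv wl vv j a = if a is Some i then rS j i else hS j.
  rewrite /layer_sum; case: a => [i|]; last by rewrite sum_wheel_hub.
  by rewrite sum_wheel_rim // /wl wheel_weightS // wheel_weightP.
have wN j i : wl j (Some i) None = sp j i by [].
have wS j i : wl j (Some i) (Some (ordS i)) = re j i by apply: wheel_weightS.
have wP j i : wl j (Some i) (Some (ord_pred i)) = re j (ord_pred i).
  exact: wheel_weightP.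
apply: (@nsd_cart_cycle _ n n2 k cv wl vv).
- by move=> j a b; apply: wheel_weightC.
- by move=> j [i|]; [have [] := rR' j i | have [] := hR' j].
- move=> j [i|].
    by move=> b /(adj_wheel_rim m2) [] ->;
      rewrite ?wN ?wS ?wP //;
      [have [] := rR' j i | have [] := rR' j i | have [] := rR' j (ord_pred i)].
  by case=> [i|] // _; have [] := rR' j i.
- by move=> j [i|]; [have [] := rR' j i | have [] := hR' j].
- move=> j [i|].
    move=> b /(adj_wheel_rim m2) [] -> /=; [by have [] := rP' j i | by have [] := rP' j i |].
    by have [_ + _] := rP' j (ord_pred i); rewrite ord_predK eq_sym.
  by case=> [i|] // _; rewrite eq_sym /=; have [] := rP' j i.
- by move=> j [i|] /=; [have [] := rP' j i | exact: hP].
- move=> j [i|].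
    move: (rU j i); rewrite 6!cons_uniq !inE !negb_or.
    move=> /and5P [_ /and4P [s1 s2 _ _] /and3P [r1 _ _] _ _].
    move=> b c /(adj_wheel_rim m2) [] -> /(adj_wheel_rim m2) [] ->; rewrite ?eqxx // => _;
      rewrite ?wN ?wS ?wP //= 1?eq_sym //.
  move: (hU j); rewrite 3!cons_uniq => /and4P [_ _ _ spU].
  case=> [i|] // [i'|] // _ _ /=; apply: contra_neq => e.
  (* [injectiveb] unfolds to the uniqueness of the list of spoke colors, which is [spU]. *)
  have /injectiveP inj : injectiveb (sp j) by [].
  by congr Some; apply: inj.
- move=> j [i|] b.
    move: (rU j i); rewrite 6!cons_uniq !inE !negb_or.
    move=> /and5P [/and5P [c1 c2 c3 c4 c5] /and4P [s1 s2 s3 s4]].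
    move=> /and3P [r1 r2 r3] /andP [p1 p2] _.
    move=> /(adj_wheel_rim m2) [] ->; rewrite ?wN ?wS ?wP //=;
      by rewrite ?[_ == rv j i]eq_sym; apply/and3P.
  case: b => [i|] // _; have := hU j.
  rewrite /= !inE !negb_or => /and4P [/and3P [_ _ h1] /andP [_ h2] h3 _].
  have spm : sp j i \in [seq sp j i | i <- enum 'I_m] by rewrite map_f ?mem_enum.
  by apply/and3P; split; apply: contraTneq spm => ->.
- move=> j [i|] /=.
    move: (rU j i); rewrite 6!cons_uniq !inE !negb_or.
    by move=> /and5P [/and5P [_ _ _ -> ->] _ _ _ /andP [-> _]].
  have := hU j; rewrite /= !inE !negb_or.
  by move=> /and4P [/and3P [-> -> _] /andP [-> _] _ _].
- move=> j a b; rewrite !sumE; case: a => [i|].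
    move=> /(adj_wheel_rim m2) [] -> /=; [by have [] := rD' j i | by have [] := rD' j i |].
    by have [_ + _] := rD' j (ord_pred i); rewrite ord_predK eq_sym.
  by case: b => [i|] // _; rewrite eq_sym /=; have [] := rD' j i.
- by move=> j a; rewrite !sumE; case: a => [i|]; [have [] := rD' j i | exact: hD].
Qed.

(** * Greedy coloring for at least eleven rim vertices *)

Lemma fresh_color (k : nat) (s : seq nat) :
  size s < k -> exists2 c, 1 <= c <= k & c \notin s.
Proof.
move=> sk; have /allPn [c] : ~~ all (mem s) (iota 1 k).
  apply: contraL sk => /allP sub; rewrite -leqNgt -{1}(size_iota 1 k).
  exact: uniq_leq_size (iota_uniq _ _) sub.
by rewrite mem_iota add1n ltnS; exists c.
Qed.

(* The truncated difference [c y + s y - s x] still covers every bad color of [x]. *)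
Lemma greedy_coloring (T : finType) (N : T -> seq T) (F : T -> seq nat)
    (s : T -> nat) (k : nat) :
  (forall x y, y \in N x -> x \in N y) ->
  (forall x, x \notin N x) ->
  (forall x, size (F x) + 2 * size (N x) < k) ->
  exists c : T -> nat,
    [/\ forall x, 1 <= c x <= k,
        forall x, c x \notin F x
      & forall x y, y \in N x -> c x != c y /\ s x + c x != s y + c y].
Proof.
move=> NC Nirr FN.
(* Induction on the list of vertices treated so far. The other vertices carry a color in range that
   is subject to no further condition. *)
suff /(_ (enum T)) [] : forall l : seq T, exists c : T -> nat,
    [/\ forall x, 1 <= c x <= k,
        forall x, x \in l -> c x \notin F x
      & forall x y, x \in l -> y \in l -> y \in N x ->
          c x != c y /\ s x + c x != s y + c y].
  move=> c [ck cF cN]; exists c; split=> // [x|x y]; first by rewrite cF ?mem_enum.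
  by apply: cN; rewrite mem_enum.
elim=> [|x l [c [ck cF cN]]].
  exists (fun=> 1); split=> // x.
  by have := FN x; lia.
pose bad := F x ++ map c (N x) ++ [seq c y + s y - s x | y <- N x].
have [|d dk dbad] := @fresh_color k bad.
  by rewrite !size_cat !size_map; have := FN x; lia.
have badN y : y \in N x -> d != c y /\ s x + d != s y + c y.
  move=> yN; split; apply: contraNneq dbad => e; rewrite !mem_cat.
    by rewrite e map_f ?orbT.
  apply/or3P/Or33/mapP; exists y => //; lia.
exists (fun y => if y == x then d else c y); split=> [y|y|y z].
- by case: eqP.
- rewrite inE; case: eqP => [-> _|_] /=; last exact: cF.
  by apply: contra dbad => dF; rewrite mem_cat dF.
- rewrite !inE; case: (eqVneq y x) => [->|yx]; case: (eqVneq z x) => [->|zx] //=.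
  + by rewrite (negbTE (Nirr x)).
  + by move=> _ _; apply: badN.
  + by move=> _ _ /NC /badN [] h1 h2; rewrite eq_sym h1 eq_sym h2.
  + exact: cN.
Qed.

(** [mu j] is the color reserved to be missing at hub [j]. The families [he], [hv], [mu] are chosen
    in this order, each by a greedy pass along the cycle. *)
Lemma hub_cycle_coloring (n k : nat) : 2 < n -> 7 < k ->
  exists hv he mu : 'I_n -> nat,
    [/\ forall j, all (fun c => 1 <= c <= k) [:: hv j; he j; mu j],
        forall j, uniq [:: mu j; hv j; he j; he (ord_pred j)],
        forall j, hv j != hv (ordS j)
      & forall j, mu j != mu (ordS j)].
Proof.
move=> n2 k7; have n1 := ltnW n2.
pose N (j : 'I_n) := [:: ordS j; ord_pred j].
have NC i j : j \in N i -> i \in N j.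
  by rewrite !inE => /orP [] /eqP ->; rewrite ?ordSK ?ord_predK eqxx ?orbT.
have Nirr j : j \notin N j.
  by rewrite !inE negb_or ![j == _]eq_sym ordS_neq ?ord_pred_neq.
(* With [s = 0] the condition on sums repeats the one on colors, but each neighbour still counts
   twice: [3 + 2 * 2 = 7] colors are excluded. *)
have gr F : (forall j, size (F j) <= 3) ->
    exists c : 'I_n -> nat, [/\ forall j, 1 <= c j <= k,
      forall j, c j \notin F j & forall j, c j != c (ordS j)].
  move=> F3; have [|c [ck cF cN]] := greedy_coloring (F := F) (fun=> 0) NC Nirr (k := k).
    by move=> j; have := F3 j; rewrite /=; lia.
  by exists c; split=> // j; have [] := cN j (ordS j) _; rewrite // inE eqxx.
have [he [heR _ heN]] := gr (fun=> [::]) (fun=> isT).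
have [hv [hvR hvF hvN]] := gr (fun j => [:: he j; he (ord_pred j)]) (fun=> isT).
have [mu [muR muF muN]] := gr (fun j => [:: hv j; he j; he (ord_pred j)]) (fun=> isT).
exists hv, he, mu; split=> // j; first by rewrite /= hvR heR muR.
rewrite !cons_uniq muF hvF mem_seq1 /= andbT.
by have := heN (ord_pred j); rewrite ord_predK eq_sym.
Qed.

(** The rims span a torus grid, in which every edge meets six others. It also meets the two spokes
    at its ends, and the greedy count is [2 + 2 * 6 = 14]. *)
Lemma torus_edge_coloring (m n k : nat) (sp : 'I_n -> 'I_m -> nat) :
  2 < m -> 2 < n -> 14 < k ->
  exists re ve : 'I_n -> 'I_m -> nat,
    [/\ forall j i, 1 <= re j i <= k, forall j i, 1 <= ve j i <= k
      & forall j i, uniq [:: sp j i; re j i; re j (ord_pred i); ve j i;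
                             ve (ord_pred j) i]].
Proof.
move=> m2 n2 k14; have m1 := ltnW m2; have n1 := ltnW n2.
(* The boolean is [true] for the rim edge from [i] to [ordS i] in layer [j], and [false] for the
   edge from layer [j] to layer [ordS j] at [i]. *)
pose N (e : 'I_n * 'I_m * bool) := let: (j, i, b) := e in
  if b then [:: (j, ordS i, true); (j, ord_pred i, true); (j, i, false);
                (ord_pred j, i, false); (j, ordS i, false);
                (ord_pred j, ordS i, false)]
  else [:: (ordS j, i, false); (ord_pred j, i, false); (j, i, true);
           (j, ord_pred i, true); (ordS j, i, true); (ordS j, ord_pred i, true)].
pose F (e : 'I_n * 'I_m * bool) := let: (j, i, b) := e in
  if b then [:: sp j i; sp j (ordS i)] else [:: sp j i; sp (ordS j) i].
have NC e f : f \in N e -> e \in N f.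
  case: e => [[j i] []]; rewrite !inE => /or4P [|||/or3P []] /eqP ->;
  by rewrite !inE ?ordSK ?ord_predK ?eqxx ?orbT.
have Nirr e : e \notin N e.
  case: e => [[j i] []]; rewrite !inE !xpair_eqE !eqxx ?andbF ?andbT ?orbF /=;
  by rewrite negb_or ![_ == ordS _]eq_sym ![_ == ord_pred _]eq_sym
    ?ordS_neq ?ord_pred_neq.
have [|c [ck cF cN]] := greedy_coloring (F := F) (fun=> 0) NC Nirr (k := k).
  by move=> [[j i] []]; rewrite /=; lia.
exists (fun j i => c (j, i, true)), (fun j i => c (j, i, false)); split=> // j i.
have neq e f : f \in N e -> c e != c f by move=> /cN [].
have r1 : sp j i != c (j, i, true).
  by have := cF (j, i, true); rewrite !inE negb_or eq_sym => /andP [].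
have r2 : sp j i != c (j, ord_pred i, true).
  have := cF (j, ord_pred i, true); rewrite !inE negb_or ord_predK.
  by rewrite [_ == sp j i]eq_sym => /andP [].
have v1 : sp j i != c (j, i, false).
  by have := cF (j, i, false); rewrite !inE negb_or eq_sym => /andP [].
have v2 : sp j i != c (ord_pred j, i, false).
  have := cF (ord_pred j, i, false); rewrite !inE negb_or ord_predK.
  by rewrite [_ == sp j i]eq_sym => /andP [].
rewrite /= !inE !negb_or r1 r2 v1 v2 /=.
by rewrite !neq // !inE ?ord_predK ?eqxx ?orbT.
Qed.

(** In the application [F] lists the hub color and the five edge colors at a rim vertex, and [s] is
    the sum of these edge colors. Four neighbours give the count [6 + 2 * 4 = 14]. *)
Lemma torus_vertex_coloring (m n k : nat) (F : 'I_n -> 'I_m -> seq nat)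
    (s : 'I_n -> 'I_m -> nat) :
  2 < m -> 2 < n -> 14 < k -> (forall j i, size (F j i) <= 6) ->
  exists rv : 'I_n -> 'I_m -> nat,
    [/\ forall j i, 1 <= rv j i <= k,
        forall j i, rv j i \notin F j i,
        forall j i, rv j i != rv j (ordS i) /\
          s j i + rv j i != s j (ordS i) + rv j (ordS i)
      & forall j i, rv j i != rv (ordS j) i /\
          s j i + rv j i != s (ordS j) i + rv (ordS j) i].
Proof.
move=> m2 n2 k14 F6; have m1 := ltnW m2; have n1 := ltnW n2.
pose N (x : 'I_n * 'I_m) := let: (j, i) := x in
  [:: (j, ordS i); (j, ord_pred i); (ordS j, i); (ord_pred j, i)].
have NC e f : f \in N e -> e \in N f.
  by case: e => [j i]; rewrite !inE => /or4P [] /eqP ->;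
    rewrite !inE ?ordSK ?ord_predK ?eqxx ?orbT.
have Nirr e : e \notin N e.
  case: e => [j i]; rewrite !inE !xpair_eqE !eqxx ?andbT /= !negb_or.
  by rewrite ![_ == ordS _]eq_sym ![_ == ord_pred _]eq_sym ?ordS_neq ?ord_pred_neq.
have [|c [ck cF cN]] :=
  greedy_coloring (F := fun x => F x.1 x.2) (fun x => s x.1 x.2) NC Nirr (k := k).
  by move=> [j i]; have := F6 j i; rewrite /=; lia.
exists (fun j i => c (j, i)); split=> // j i.
- by apply: (cN (j, i) (j, ordS i)); rewrite !inE eqxx.
- by apply: (cN (j, i) (ordS j, i)); rewrite !inE eqxx !orbT.
Qed.

Lemma nsd_wheel_cycle_large (m n : nat) : 10 < m -> 2 < n ->
  nsd_total_colorable (cart_prod (wheel m) (cycle_graph n)) (m + 4).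
Proof.
move=> m10 n2; have m2 : 2 < m by lia.
have [|hv [he [mu [hR hU hP muP]]]] := @hub_cycle_coloring n (m + 4) n2; first by lia.
(* Removing the four colors of [B j] from the [m + 4] available ones leaves exactly [m]. These go to
   the spokes of layer [j], so hub [j] sees every color but [mu j]. *)
pose B j := [:: mu j; hv j; he j; he (ord_pred j)].
pose A j := [seq c <- iota 1 (m + 4) | c \notin B j].
have BR j : {subset B j <= iota 1 (m + 4)}.
  move=> c cB; rewrite mem_iota; move: cB (hR j) (hR (ord_pred j)).
  by rewrite !inE /= => /or4P [] /eqP ->; lia.
have perm_iota j : perm_eq (B j ++ A j) (iota 1 (m + 4)).
  rewrite perm_sym -(perm_filterC [in B j]) perm_cat2r perm_sym.
  apply: uniq_perm; [exact: hU | exact/filter_uniq/iota_uniq |].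
  move=> c; rewrite mem_filter; apply/idP/andP => [cB|[]] //.
  by split=> //; apply: (BR j).
have sizeA j : size (A j) = m.
  by have := perm_size (perm_iota j); rewrite size_cat size_iota /=; lia.
pose sp j (i : 'I_m) := nth 0 (A j) i.
have spA j : [seq sp j i | i <- enum 'I_m] = A j.
  by rewrite /sp map_comp val_enum_ord -{1}(sizeA j) -/(mkseq _ _) mkseq_nth.
have spR j i : 1 <= sp j i <= m + 4.
  have : sp j i \in A j by rewrite mem_nth ?sizeA.
  by rewrite mem_filter mem_iota; lia.
have [|re [ve [reR veR rU]]] := @torus_edge_coloring m n (m + 4) sp m2 n2; first by lia.
pose E j i := [:: sp j i; re j i; re j (ord_pred i); ve j i; ve (ord_pred j) i].
have [||rv [rvR rvF rvI rvJ]] := @torus_vertex_coloring m n (m + 4)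
  (fun j i => hv j :: E j i)
  (fun j i => sp j i + (re j i + re j (ord_pred i)) + ve j i + ve (ord_pred j) i) m2 n2;
  rewrite //; first by lia.
have hubE j : mu j + (hv j + (\sum_i sp j i + he j + he (ord_pred j))) =
              sumn (iota 1 (m + 4)).
  have -> : \sum_i sp j i = sumn (A j) by rewrite -spA sumnE big_map big_enum.
  by rewrite -(perm_sumn (perm_iota j)) sumn_cat /=; lia.
(* Doubled to avoid a division. A hub sum is at least the total of all colors minus [m + 4], whereas
   a rim sum has six terms and is at most [6 * (m + 4)]. *)
have sum_iota : 12 * (m + 4) < 2 * sumn (iota 1 (m + 4)) - 2 * (m + 4).
  have -> : 2 * sumn (iota 1 (m + 4)) = (m + 4) * (m + 4).+1.
    elim: (m + 4) => // k IH.
    by rewrite -{1}(addn1 k) iotaD sumn_cat mulnDr IH /=; lia.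
  nia.
apply: (@nsd_wheel_cycle m n (m + 4) hv he rv sp re ve m2 n2); split=> //.
- by move=> j; have := hR j; rewrite /=; lia.
- by move=> j i; rewrite /= rvR spR reR veR.
- move=> j; have := iota_uniq 1 (m + 4); rewrite -(perm_uniq (perm_iota j)) spA.
  by case/andP.
- move=> j i; rewrite cons_uniq rU andbT.
  by have := rvF j i; rewrite inE negb_or => /andP [].
- move=> j i; rewrite !inE !negb_or; have := rvF j i; rewrite inE negb_or => /andP [-> _].
  by have [-> _] := rvI j i; have [-> _] := rvJ j i.
(* A hub sum and its missing color add up to the same total in every layer, so equal sums force
   equal missing colors. *)
- move=> j; apply: contra_neq (muP j) => e; apply/eqP.
  by rewrite -(eqn_add2r (hv j + (\sum_i sp j i + he j + he (ord_pred j)))) {2}e !hubE.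
- move=> j i; rewrite !inE !negb_or; apply/and3P; split.
  + have := hubE j; have := hR j; have := rvR j i; have := spR j i.
    have := reR j i; have := reR j (ord_pred i); have := veR j i.
    by have := veR (ord_pred j) i; rewrite /=; lia.
  + by have [_] := rvI j i; rewrite addnC [X in _ != X]addnC.
  + by have [_] := rvJ j i; rewrite addnC [X in _ != X]addnC.
Qed.

(** * Periodic patterns for three to ten rim vertices *)

(* Layers are of seven types 0, ..., 6 and follow one another along a closed walk
   whose steps are listed in [steps]. The edges between two consecutive layers are
   of one of five classes, determined by the type of either layer. *)
Definition steps : seq (nat * nat) :=
  [:: (0, 1); (1, 2); (2, 0); (1, 3); (3, 4); (4, 0); (3, 5); (5, 6); (6, 0)].
Definition class_in (l : nat) : nat := nth 0 [:: 0; 1; 2; 2; 3; 3; 4] l.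
Definition class_out (l : nat) : nat := nth 0 [:: 1; 2; 0; 3; 0; 4; 0] l.

(* The walk [(012)^q], [(012)^q 0134] or [(012)^q 01356] of length [n]. *)
Definition layer_type (n j : nat) : nat :=
  match n %% 3, n - j with
  | 1, 2 => 3
  | 1, 1 => 4
  | 2, 3 => 3
  | 2, 2 => 5
  | 2, 1 => 6
  | _, _ => j %% 3
  end.

Lemma layer_type_step (n : nat) (j : 'I_n) :
  2 < n -> (layer_type n j, layer_type n (ordS j)) \in steps.
Proof.
move=> n2; rewrite val_ordS; have := ltn_ord j; move: (nat_of_ord j) => {}j jn.
have [q [r [nE r3]]] : exists q r, n = q * 3 + r /\ r < 3.
  by exists (n %/ 3), (n %% 3); rewrite -divn_eq ltn_mod.
have [p [s [jE s3]]] : exists p s, j = p * 3 + s /\ s < 3.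
  by exists (j %/ 3), (j %% 3); rewrite -divn_eq ltn_mod.
have nr : n %% 3 = r by rewrite nE modnMDl modn_small.
have js : j %% 3 = s by rewrite jE modnMDl modn_small.
have jS : j.+1 %% 3 = s.+1 %% 3 by rewrite jE -addnS modnMDl.
rewrite /layer_type nr; case: eqP => [ejn|ejn].
  have -> : n - j = 1 by lia.
  (* The last layer is followed by layer 0. That layer has type 0: remainder 1 forces [n >= 4] and
     remainder 2 forces [n >= 5], so it lies before the exceptional tail. *)
  have [d dE] : exists d, n - 0 = d.+3 by exists (n - 3); lia.
  rewrite dE js.
  by case: r s {nr js jS} r3 s3 nE jE => [|[|[|r]]] [|[|[|s]]] //;
    case: d dE => [|d] //; lia.
rewrite jS js.
(* Away from the wrap-around, the two types depend only on both remainders and on whether [n - j] is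
   2, 3, 4 or larger. *)
have [d dE] : exists d, n - j = d.+2 by exists (n - j).-2; lia.
have -> : n - j.+1 = d.+1 by lia.
rewrite dE.
by case: r s {nr js jS} r3 s3 nE jE => [|[|[|r]]] [|[|[|s]]] //;
  case: d dE => [|[|[|d]]] //; lia.
Qed.

Record pattern := Pattern {
  hub_table : seq nat;
  rim_table : seq (seq nat);
  spoke_table : seq (seq nat);
  rim_edge_table : seq (seq nat);
  (* one row per class, the hub edge coming first *)
  cross_table : seq (seq nat) }.

(** The default 0 is not a color, so the range tests of [layer_ok] detect a missing entry. *)
Definition entry (t : seq (seq nat)) (l i : nat) : nat := nth 0 (nth [::] t l) i.

Section Pattern.

Variables (m : nat) (p : pattern).

Let hv l := nth 0 (hub_table p) l.
Let rv := entry (rim_table p).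
Let sp := entry (spoke_table p).
Let re := entry (rim_edge_table p).
Let cr := entry (cross_table p).
Let hin l := cr (class_in l) 0.
Let hout l := cr (class_out l) 0.
Let vin l i := cr (class_in l) i.+1.
Let vout l i := cr (class_out l) i.+1.
(** [succ] and [pred] are convertible with the values of [ordS] and [ord_pred]. In [pred], adding
    [m] first sends 0 to [m - 1]. *)
Let succ i := i.+1 %% m.
Let pred i := (i + m).-1 %% m.
Let in_range c := 1 <= c <= m + 4.
Let rows := iota 0 m.
Let hsum l := hv l + (sumn [seq sp l i | i <- rows] + hout l + hin l).
Let rsum l i := rv l i + (sp l i + (re l i + re l (pred i)) + vout l i + vin l i).

(** Incoming cross colors get no range test of their own, since each class that enters some layer
    also leaves one. *)
Definition layer_ok (l : nat) : bool :=
  [&& all in_range [:: hv l; hout l],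
      uniq [:: hv l, hout l, hin l & [seq sp l i | i <- rows]]
    & all (fun i =>
        [&& all in_range [:: rv l i; sp l i; re l i; vout l i],
            uniq [:: rv l i; sp l i; re l i; re l (pred i); vout l i; vin l i],
            rv l i \notin [:: hv l; rv l (succ i)]
          & rsum l i \notin [:: hsum l; rsum l (succ i)]]) rows].

Definition step_ok (s : nat * nat) : bool :=
  let: (l, r) := s in
  [&& hv l != hv r, hsum l != hsum r
    & all (fun i => (rv l i != rv r i) && (rsum l i != rsum r i)) rows].

Definition pattern_ok : bool := all layer_ok (iota 0 7) && all step_ok steps.

(** Every condition of [wheel_cycle_coloring] depends only on the type of one layer or on the types
    of two consecutive layers. Seven layer tests and nine step tests therefore settle all [n] at
    once. *)
Lemma nsd_of_pattern (n : nat) : 2 < m -> 2 < n -> pattern_ok ->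
  nsd_total_colorable (cart_prod (wheel m) (cycle_graph n)) (m + 4).
Proof.
move=> m2 n2 /andP [/allP lok /allP sok].
pose t (j : 'I_n) := layer_type n j.
have tS j : (t j, t (ordS j)) \in steps by apply: layer_type_step.
have t7 j : t j \in iota 0 7.
  have : all (fun s => s.1 \in iota 0 7) steps by [].
  by move/allP/(_ _ (tS j)).
(* Along each permitted step the class leaving the first layer is the class entering the second. The
   colors arriving at a layer are thus determined by its own type. *)
have classE j : class_out (t (ord_pred j)) = class_in (t j).
  have : all (fun s => class_out s.1 == class_in s.2) steps by [].
  by move/allP/(_ _ (tS (ord_pred j)))/eqP; rewrite ord_predK.
have houtE j : hout (t (ord_pred j)) = hin (t j) by rewrite /hout classE.
have voutE j i : vout (t (ord_pred j)) i = vin (t j) i by rewrite /vout classE.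
have mapE l : [seq sp l (val i) | i <- enum 'I_m] = [seq sp l i | i <- rows].
  by rewrite (map_comp (sp l) val) val_enum_ord.
have sumE l : \sum_(i < m) sp l i = sumn [seq sp l i | i <- rows].
  by rewrite -mapE sumnE big_map big_enum.
have inr (i : 'I_m) : val i \in rows by rewrite mem_iota ltn_ord.
have L j : layer_ok (t j) by apply: lok.
have S j : step_ok (t j, t (ordS j)) by apply: sok.
have hE j : hv (t j) + (\sum_(i < m) sp (t j) i + hout (t j) + hout (t (ord_pred j)))
            = hsum (t j).
  by rewrite /hsum sumE houtE.
have rE j (i : 'I_m) :
    rv (t j) i + (sp (t j) i + (re (t j) i + re (t j) (ord_pred i))
                  + vout (t j) i + vout (t (ord_pred j)) i)
    = rsum (t j) i.
  by rewrite /rsum voutE.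
apply: (@nsd_wheel_cycle m n (m + 4) (fun j => hv (t j)) (fun j => hout (t j))
  (fun j i => rv (t j) i) (fun j i => sp (t j) i) (fun j i => re (t j) i)
  (fun j i => vout (t j) i) m2 n2); split.
- by move=> j; case/and3P: (L j).
- by move=> j i; case/and3P: (L j) => _ _ /allP /(_ _ (inr i)) /and4P [].
- by move=> j; rewrite mapE houtE; case/and3P: (L j).
- move=> j i; rewrite voutE.
  by case/and3P: (L j) => _ _ /allP /(_ _ (inr i)) /and4P [].
- by move=> j; case/and3P: (S j).
- move=> j i; have /and3P [_ _ /allP /(_ _ (inr i)) /and4P [_ _ h _]] := L j.
  have /and3P [_ _ /allP /(_ _ (inr i)) /andP [h' _]] := S j.
  by move: h; rewrite !inE !negb_or h' andbT.
- by move=> j; rewrite !hE; case/and3P: (S j).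
- move=> j i; have /and3P [_ _ /allP /(_ _ (inr i)) /and4P [_ _ _ h]] := L j.
  have /and3P [_ _ /allP /(_ _ (inr i)) /andP [_ h']] := S j.
  by move: h; rewrite !inE !negb_or !hE !rE h' andbT.
Qed.

End Pattern.

(* Found by a computer search; entry [m - 3] is for the wheel with [m] rim vertices. *)
Definition patterns : seq pattern :=
[::
  Pattern [:: 7; 6; 2; 3; 5; 5; 2]
    [:: [:: 2; 1; 3]; [:: 3; 2; 5]; [:: 1; 3; 6]; [:: 2; 1; 7]; [:: 7; 3; 1];
        [:: 4; 7; 2]; [:: 5; 6; 4]]
    [:: [:: 5; 2; 1]; [:: 1; 3; 2]; [:: 3; 4; 5]; [:: 1; 5; 6]; [:: 1; 2; 3];
        [:: 2; 3; 6]; [:: 7; 4; 3]]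
    [:: [:: 3; 4; 6]; [:: 5; 1; 4]; [:: 2; 1; 7]; [:: 7; 2; 5]; [:: 6; 7; 5];
        [:: 5; 1; 7]; [:: 3; 7; 1]]
    [:: [:: 6; 4; 5; 2]; [:: 4; 7; 7; 7]; [:: 7; 6; 6; 3]; [:: 4; 3; 4; 4];
        [:: 1; 6; 2; 5]];
  Pattern [:: 2; 1; 6; 6; 1; 4; 3]
    [:: [:: 5; 6; 3; 8]; [:: 2; 7; 4; 3]; [:: 1; 2; 8; 5]; [:: 3; 2; 1; 7];
        [:: 8; 4; 5; 6]; [:: 7; 6; 5; 1]; [:: 8; 7; 1; 5]]
    [:: [:: 8; 3; 7; 1]; [:: 4; 6; 7; 2]; [:: 2; 8; 1; 7]; [:: 8; 4; 7; 5];
        [:: 7; 3; 6; 5]; [:: 5; 8; 6; 3]; [:: 7; 8; 5; 6]]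
    [:: [:: 2; 8; 5; 4]; [:: 8; 3; 6; 5]; [:: 7; 3; 2; 8]; [:: 5; 6; 8; 4];
        [:: 6; 8; 1; 4]; [:: 3; 4; 7; 6]; [:: 4; 6; 7; 2]]
    [:: [:: 4; 3; 5; 4; 3]; [:: 5; 7; 4; 2; 7]; [:: 3; 6; 1; 5; 1]; [:: 2; 2; 7; 3; 2];
        [:: 1; 1; 2; 2; 4]];
  Pattern [:: 5; 1; 7; 8; 2; 9; 1]
    [:: [:: 3; 4; 3; 9; 6]; [:: 4; 9; 7; 2; 5]; [:: 8; 2; 9; 1; 4]; [:: 6; 7; 2; 4; 7];
        [:: 5; 6; 5; 6; 9]; [:: 2; 8; 4; 8; 5]; [:: 4; 9; 5; 6; 8]]
    [:: [:: 4; 3; 1; 2; 7]; [:: 8; 3; 9; 5; 7]; [:: 6; 4; 3; 9; 5]; [:: 7; 6; 3; 1; 5];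
        [:: 9; 1; 6; 3; 7]; [:: 8; 5; 3; 2; 1]; [:: 9; 6; 4; 2; 5]]
    [:: [:: 6; 5; 8; 5; 1]; [:: 7; 6; 1; 3; 6]; [:: 1; 6; 5; 3; 7]; [:: 8; 9; 7; 2; 4];
        [:: 8; 9; 2; 5; 4]; [:: 6; 2; 7; 6; 4]; [:: 5; 3; 8; 9; 6]]
    [:: [:: 8; 2; 7; 7; 4; 2]; [:: 6; 5; 8; 2; 6; 8]; [:: 2; 9; 5; 4; 8; 1];
        [:: 4; 1; 4; 1; 9; 3]; [:: 7; 3; 1; 6; 3; 7]];
  Pattern [:: 4; 9; 1; 6; 9; 9; 1]
    [:: [:: 7; 5; 10; 2; 9; 1]; [:: 3; 2; 4; 3; 2; 10]; [:: 5; 9; 2; 4; 6; 7];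
        [:: 5; 7; 1; 2; 4; 7]; [:: 8; 4; 2; 3; 5; 2]; [:: 6; 2; 6; 10; 7; 2];
        [:: 3; 10; 3; 6; 8; 5]]
    [:: [:: 3; 10; 9; 6; 1; 8]; [:: 6; 3; 1; 2; 8; 7]; [:: 8; 6; 3; 7; 5; 4];
        [:: 1; 8; 2; 4; 9; 3]; [:: 5; 10; 3; 6; 1; 8]; [:: 1; 5; 2; 4; 10; 3];
        [:: 10; 4; 5; 9; 6; 7]]
    [:: [:: 9; 4; 1; 5; 6; 10]; [:: 5; 9; 7; 1; 9; 8]; [:: 3; 5; 6; 8; 1; 10];
        [:: 9; 10; 7; 1; 8; 10]; [:: 1; 6; 9; 7; 3; 10]; [:: 7; 8; 5; 9; 1; 8];
        [:: 9; 2; 4; 1; 4; 1]]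
    [:: [:: 2; 6; 8; 7; 10; 2; 9]; [:: 5; 1; 6; 5; 4; 7; 3]; [:: 10; 2; 4; 8; 9; 10; 5];
        [:: 7; 4; 3; 4; 8; 6; 4]; [:: 8; 2; 6; 1; 3; 3; 6]];
  Pattern [:: 3; 2; 5; 8; 9; 2; 6]
    [:: [:: 4; 11; 9; 7; 9; 10; 6]; [:: 7; 8; 6; 4; 10; 1; 4]; [:: 3; 10; 7; 10; 6; 8; 7];
        [:: 5; 1; 10; 2; 7; 6; 9]; [:: 8; 4; 7; 10; 8; 11; 2]; [:: 10; 11; 9; 5; 4; 7; 6];
        [:: 1; 2; 1; 9; 3; 4; 7]]
    [:: [:: 7; 9; 10; 8; 4; 2; 5]; [:: 6; 1; 3; 10; 4; 5; 9]; [:: 2; 11; 6; 9; 4; 10; 8];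
        [:: 3; 2; 6; 10; 9; 5; 11]; [:: 5; 6; 11; 8; 2; 10; 3]; [:: 8; 3; 11; 7; 5; 6; 1];
        [:: 7; 8; 11; 3; 4; 9; 2]]
    [:: [:: 8; 7; 6; 10; 5; 7; 3]; [:: 10; 4; 8; 9; 8; 7; 11]; [:: 8; 1; 2; 3; 7; 2; 1];
        [:: 11; 8; 1; 4; 10; 7; 2]; [:: 7; 1; 6; 5; 7; 8; 10]; [:: 7; 6; 2; 8; 1; 4; 2];
        [:: 3; 7; 2; 7; 10; 3; 4]]
    [:: [:: 1; 6; 5; 3; 4; 1; 6; 11]; [:: 11; 1; 2; 11; 2; 3; 3; 2];
        [:: 7; 4; 9; 5; 5; 5; 4; 10]; [:: 4; 1; 10; 4; 11; 3; 2; 5];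
        [:: 10; 9; 9; 5; 1; 6; 5; 9]];
  Pattern [:: 11; 8; 4; 1; 3; 12; 9]
    [:: [:: 7; 9; 6; 12; 9; 3; 7; 8]; [:: 4; 6; 9; 4; 2; 9; 4; 5];
        [:: 3; 1; 11; 8; 12; 1; 6; 11]; [:: 11; 2; 7; 12; 9; 5; 8; 6];
        [:: 8; 11; 4; 10; 5; 8; 11; 4]; [:: 9; 11; 1; 10; 7; 6; 7; 10];
        [:: 5; 8; 5; 3; 12; 5; 2; 6]]
    [:: [:: 1; 5; 7; 6; 3; 8; 10; 12]; [:: 5; 4; 2; 11; 3; 12; 1; 6];
        [:: 5; 9; 10; 6; 1; 11; 8; 12]; [:: 6; 3; 2; 8; 12; 9; 10; 5];
        [:: 5; 12; 9; 1; 6; 10; 4; 8]; [:: 10; 3; 8; 6; 2; 9; 5; 7];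
        [:: 12; 11; 1; 8; 10; 3; 7; 5]]
    [:: [:: 3; 12; 1; 11; 10; 12; 3; 5]; [:: 2; 7; 5; 12; 5; 7; 12; 11];
        [:: 2; 3; 5; 9; 4; 12; 9; 7]; [:: 5; 1; 9; 7; 10; 12; 4; 2];
        [:: 1; 3; 2; 11; 1; 3; 5; 9]; [:: 8; 5; 12; 9; 12; 1; 4; 2];
        [:: 3; 10; 4; 6; 1; 8; 4; 2]]
    [:: [:: 2; 4; 7; 8; 7; 7; 2; 1; 1]; [:: 9; 6; 10; 4; 10; 4; 11; 2; 4];
        [:: 7; 10; 11; 6; 2; 8; 8; 11; 8]; [:: 11; 7; 10; 11; 3; 3; 11; 6; 11];
        [:: 4; 11; 2; 6; 5; 4; 4; 3; 9]];
  Pattern [:: 13; 7; 3; 10; 8; 7; 9]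
    [:: [:: 4; 1; 10; 12; 3; 11; 8; 1; 7]; [:: 11; 13; 8; 3; 6; 5; 4; 8; 9];
        [:: 8; 6; 7; 9; 8; 12; 10; 6; 2]; [:: 8; 11; 12; 5; 9; 13; 7; 13; 11];
        [:: 7; 13; 9; 2; 1; 10; 5; 12; 3]; [:: 12; 10; 3; 4; 8; 4; 10; 3; 5];
        [:: 8; 12; 7; 5; 4; 13; 6; 4; 10]]
    [:: [:: 5; 7; 1; 6; 11; 9; 12; 10; 8]; [:: 9; 8; 12; 13; 11; 10; 6; 5; 3];
        [:: 6; 2; 8; 7; 12; 9; 11; 13; 5]; [:: 7; 9; 6; 3; 5; 8; 4; 12; 13];
        [:: 1; 12; 7; 3; 10; 6; 11; 13; 5]; [:: 3; 8; 6; 11; 5; 10; 4; 12; 1];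
        [:: 6; 3; 11; 8; 7; 10; 5; 12; 1]]
    [:: [:: 8; 11; 5; 13; 2; 6; 4; 9; 10]; [:: 6; 2; 6; 8; 2; 1; 10; 12; 4];
        [:: 9; 4; 3; 6; 1; 3; 2; 12; 3]; [:: 2; 8; 11; 8; 11; 9; 5; 7; 9];
        [:: 6; 3; 11; 13; 5; 9; 4; 1; 12]; [:: 6; 2; 8; 10; 9; 11; 13; 9; 10];
        [:: 7; 13; 6; 3; 6; 3; 7; 2; 9]]
    [:: [:: 4; 13; 10; 2; 10; 9; 7; 1; 8; 4]; [:: 2; 2; 4; 4; 9; 4; 12; 7; 2; 2];
        [:: 1; 1; 5; 13; 4; 10; 4; 13; 3; 6]; [:: 2; 11; 7; 5; 9; 12; 12; 12; 6; 2];
        [:: 13; 5; 4; 9; 2; 1; 5; 9; 5; 7]];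
  Pattern [:: 1; 5; 4; 11; 3; 1; 10]
    [:: [:: 7; 2; 3; 8; 11; 5; 3; 4; 6; 13]; [:: 12; 7; 11; 7; 13; 8; 13; 1; 7; 14];
        [:: 11; 3; 12; 1; 10; 12; 5; 13; 14; 8]; [:: 1; 3; 7; 2; 14; 10; 7; 2; 9; 7];
        [:: 14; 11; 12; 5; 10; 9; 10; 7; 12; 10]; [:: 9; 8; 14; 11; 8; 11; 2; 14; 11; 12];
        [:: 8; 3; 8; 7; 6; 2; 12; 11; 5; 1]]
    [:: [:: 13; 12; 11; 2; 3; 14; 5; 6; 4; 10]; [:: 4; 8; 6; 12; 3; 9; 11; 14; 2; 1];
        [:: 5; 11; 14; 13; 3; 6; 12; 9; 7; 2]; [:: 4; 5; 12; 7; 9; 2; 13; 1; 6; 3];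
        [:: 9; 7; 5; 2; 4; 1; 13; 6; 11; 12]; [:: 11; 2; 12; 7; 10; 13; 8; 6; 4; 9];
        [:: 6; 13; 2; 4; 12; 1; 3; 14; 9; 7]]
    [:: [:: 6; 8; 5; 14; 4; 2; 14; 1; 14; 2]; [:: 9; 4; 2; 8; 6; 2; 3; 6; 3; 8];
        [:: 2; 6; 3; 6; 14; 2; 8; 2; 3; 10]; [:: 11; 8; 6; 4; 13; 4; 6; 4; 11; 9];
        [:: 13; 4; 7; 8; 12; 5; 1; 14; 9; 11]; [:: 14; 7; 2; 12; 9; 1; 10; 5; 2; 6];
        [:: 1; 4; 9; 5; 9; 13; 2; 6; 11; 14]]
    [:: [:: 8; 12; 10; 1; 12; 1; 11; 6; 3; 8; 6];
        [:: 7; 5; 13; 14; 13; 10; 12; 12; 9; 12; 11];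
        [:: 10; 3; 14; 9; 9; 2; 7; 10; 12; 1; 5];
        [:: 14; 5; 9; 10; 10; 6; 14; 14; 13; 10; 1];
        [:: 5; 3; 12; 3; 1; 4; 3; 7; 9; 14; 4]]].

Lemma patterns_ok :
  all (fun m => pattern_ok m (nth (Pattern [::] [::] [::] [::] [::]) patterns (m - 3)))
    (iota 3 8).
Proof. by vm_compute. Qed.

(** * Degrees *)

Section Degree.

Variables m n : nat.
Hypotheses (m_gt2 : 2 < m) (n_gt2 : 2 < n).
Local Notation WC := (cart_prod (wheel m) (cycle_graph n)).

Lemma degree_wheel_cycle (x : WC) : degree x = if x.1 is Some _ then 5 else m + 2.
Proof.
(* The degree is counted as the sum of the constant 1 over the neighbours. *)
case: x => a j; rewrite /degree cardsE -sum1_card sum_adj_cart_cycle //=.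
case: a => [i|]; first by rewrite sum_wheel_rim.
by rewrite sum_wheel_hub sum_nat_const card_ord muln1 -addnA.
Qed.

Lemma max_degree_wheel_cycle : max_degree WC = m + 2.
Proof.
have n_gt0 : 0 < n by lia.
apply/eqP; rewrite eqn_leq; apply/andP; split.
  (* Rim vertices have degree [5 <= m + 2] because [m >= 3], with equality for [m = 3]. *)
  by apply/bigmax_leqP => x _; rewrite degree_wheel_cycle; case: x.1 => // _; lia.
have := leq_bigmax (F := @degree WC) ((None, Ordinal n_gt0) : WC).
by rewrite degree_wheel_cycle.
Qed.

End Degree.

Theorem theorem4p6 (m n : nat) (hm : 3 <= m) (hn : 3 <= n) :
  is_nsd_total_chromatic_number (cart_prod (wheel m) (cycle_graph n))
    (max_degree (cart_prod (wheel m) (cycle_graph n)) + 2).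
Proof.
rewrite max_degree_wheel_cycle // -addnA; split.
  have [m_le|m_gt] := leqP m 10; last exact: nsd_wheel_cycle_large.
  apply: nsd_of_pattern => //; apply: (allP patterns_ok).
  by rewrite mem_iota hm ltnS.
have n_gt0 : 0 < n by lia.
pose i0 := Ordinal n_gt0.
move=> k colk.
(* Two consecutive hubs are adjacent vertices of degree [m + 2], to which the palette bound
   applies. *)
have adj_hubs : @adj (cart_prod (wheel m) (cycle_graph n)) (None, i0) (None, ordS i0).
  by rewrite adj_cart_cycle // eqxx !orbT.
have := sum_distinguishing_lower_bound adj_hubs _ colk.
by rewrite !degree_wheel_cycle //= => /(_ erefl); rewrite -addn2 -addnA.
Qed.
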